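(* Consider the following sixteen types of loops $M(G,*,g_o)$. In each type $D=\langle x,y,Z(D)\rangle$ is a group with center $Z(D)$ as listed, with $D/Z(D)\cong C_2\times C_2$, generated modulo $Z(D)$ by $x$ and $y$, with $[x,y]=x^{-1}y^{-1}xy=t_1^{2^{m_1-1}}$ and with $x^2,y^2$ as listed; $o(t_i)=2^{m_i}$ with $m_i\ge 1$ arbitrary integers, $o(u_1)=o(u_2)=\infty$, $o(t)=2^k$ with $k\ge 1$ an arbitrary integer, and $o(w)=\infty$; the group $G$ is either $D$ or the direct product of $D$ with the listed cyclic group; and $u^2=g_o\in Z(G)$ is as listed. (1) $Z(D)=\langle t_1\rangle$, $x^2=1$, $y^2=1$, $G=D$, $g_o=1$. (2) $Z(D)=\langle t_1\rangle$, $x^2=t_1$, $y^2=t_1$, $G=D$, $g_o=t_1$. (3) $Z(D)=\langle t_1\rangle\times\langle t_2\rangle$, $x^2=1$, $y^2=t_2$, $G=D$, $g_o=1$. (4) $Z(D)=\langle t_1\rangle\times\langle t_2\rangle$, $x^2=t_1$, $y^2=t_2$, $G=D$, $g_o=t_1$. (5) $Z(D)=\langle t_1\rangle\times\langle u_1\rangle$, $x^2=1$, $y^2=u_1$, $G=D$, $g_o=1$. (6) $Z(D)=\langle t_1\rangle\times\langle u_1\rangle$, $x^2=t_1$, $y^2=u_1$, $G=D$, $g_o=t_1$. (7) $Z(D)=\langle t_1\rangle\times\langle t_2\rangle\times\langle t_3\rangle$, $x^2=t_2$, $y^2=t_3$, $G=D$, $g_o=1$. (8) $Z(D)=\langle t_1\rangle\times\langle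 t_2\rangle\times\langle t_3\rangle$, $x^2=t_2$, $y^2=t_3$, $G=D$, $g_o=t_1$. (9) $Z(D)=\langle t_1\rangle\times\langle t_2\rangle\times\langle t_3\rangle$, $x^2=t_2$, $y^2=t_3$, $G=D\times\langle t\rangle$, $g_o=t$. (10) $Z(D)=\langle t_1\rangle\times\langle t_2\rangle\times\langle u_1\rangle$, $x^2=t_2$, $y^2=u_1$, $G=D$, $g_o=1$. (11) $Z(D)=\langle t_1\rangle\times\langle t_2\rangle\times\langle u_1\rangle$, $x^2=t_2$, $y^2=u_1$, $G=D$, $g_o=t_1$. (12) $Z(D)=\langle t_1\rangle\times\langle t_2\rangle\times\langle u_1\rangle$, $x^2=t_2$, $y^2=u_1$, $G=D\times\langle t\rangle$, $g_o=t$. (13) $Z(D)=\langle t_1\rangle\times\langle t_2\rangle\times\langle u_1\rangle$, $x^2=t_2$, $y^2=u_1$, $G=D\times\langle w\rangle$, $g_o=w$. (14) $Z(D)=\langle t_1\rangle\times\langle u_1\rangle\times\langle u_2\rangle$, $x^2=u_1$, $y^2=u_2$, $G=D$, $g_o=1$. (15) $Z(D)=\langle t_1\rangle\times\langle u_1\rangle\times\langle u_2\rangle$, $x^2=u_1$, $y^2=u_2$, $G=D$, $g_o=t_1$. (16) $Z(D)=\langle t_1\rangle\times\langle u_1\rangle\times\langle u_2\rangle$, $x^2=u_1$, $y^2=u_2$, $G=D\times\langle w\rangle$, $g_o=w$. Then these sixteen types are distinct: if $i\ne j$, no loop of type $(i)$ is isomorphic to a loop of type $(j)$ (for any choices of the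 parameters $m_1,m_2,m_3,k$ in each).
   Context: A loop is a nonempty set $L$ with a binary operation having a two-sided identity element $1$ and such that in $a\cdot b=c$ any two of the three elements uniquely determine the third. $C_2$ is the cyclic group of order $2$, $o(\cdot)$ denotes the order of an element, and $Z(\cdot)$ denotes the center. Construction of $M(G,*,g_o)$: let $G$ be a nonabelian group with $G/Z(G)\cong C_2\times C_2$; then its commutator subgroup is $G'=\{1,s\}\subseteq Z(G)$ for some $s$ of order $2$. Let $*$ be the involution of $G$ given by $g^*=g$ if $g\in Z(G)$ and $g^*=sg$ if $g\notin Z(G)$. Let $g_o\in Z(G)$. Then $M(G,*,g_o)$ is the loop with underlying set the disjoint union $G\cup Gu$, where $u$ is an indeterminate, whose operation extends that of $G$ by $$g(hu)=(hg)u,\qquad (gu)h=(gh^* )u,\qquad (gu)(hu)=g_oh^*g\qquad (g,h\in G);$$ in particular $u^2=g_o$. *)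

(* Defs.v *)
From HB Require Import structures.
From mathcomp Require Import all_boot zmodp.
From mathcomp Require Import boolp classical_sets functions.

Set Implicit Arguments.
Unset Strict Implicit.
Unset Printing Implicit Defensive.

Import Algebra.

Local Open Scope classical_set_scope.
Local Open Scope group_scope.

(* Groups are arbitrary, possibly infinite [groupType]s, and subsets of a group
   are classical sets. *)

Section Groups.
Variable G : groupType.
Implicit Types (A B Z : set G) (g h t : G) (ts : seq G).

Definition subgroup A : Prop :=
  [/\ A 1, forall g h, A g -> A h -> A (g * h) & forall g, A g -> A g^-1].

Definition generated A : set G := smallest subgroup A.

Definition centerg : set G := [set z | forall g, commute z g].

Definition commutator_subgroup : set G :=
  generated [set c | exists g h, c = [~ g, h]].

Definition coset_set A g : set G := [set g * a | a in A].

(* For a normal subgroup A of G, G/A is isomorphic to H: the elements of G/A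
   are the cosets gA, and the product of gA and hA is (gh)A. *)
Definition quotient_isog A (H : groupType) : Prop :=
  exists phi : set G -> H,
    set_bij (range (coset_set A)) [set: H] phi /\
    forall g h,
      phi (coset_set A (g * h)) = phi (coset_set A g) * phi (coset_set A h).

Definition has_order g (n : nat) : Prop :=
  [/\ 0 < n, g ^+ n = 1 & forall k, 0 < k < n -> g ^+ k <> 1].

Definition has_infinite_order g : Prop := forall k, 0 < k -> g ^+ k <> 1.

Definition is_dprod A B Z : Prop :=
  [/\ Z = [set g | exists a b, [/\ A a, B b & g = a * b]],
      A `&` B = [set 1]
    & forall a b, A a -> B b -> commute a b].

(* Z is the internal direct product of the cyclic subgroups generated by the
   terms of ts. *)
Fixpoint is_cyclic_dprod ts Z : Prop :=
  match ts with
  | [::] => Z = [set 1]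
  | t :: ts' =>
      exists2 B, is_cyclic_dprod ts' B & is_dprod (generated [set t]) B Z
  end.

End Groups.

Arguments centerg G : clear implicits.
Arguments commutator_subgroup G : clear implicits.

Definition C2 : groupType := 'Z_2.

(* C2 being 'Z_2 with addition as its group law, this is C_2 x C_2; a group
   satisfying this predicate is nonabelian since the quotient is nontrivial. *)
Definition central_quotient_klein (G : groupType) : Prop :=
  quotient_isog (centerg G) (C2 * C2)%type.

(* The element s such that G' = {1, s}; it exists, and has order 2, when
   [central_quotient_klein G] holds (lemma [commutator_eltP] below). *)
Definition commutator_elt (G : groupType) : G :=
  xget 1 [set s | commutator_subgroup G = [set 1; s]].

Definition starg (G : groupType) (g : G) : G :=
  if g \in centerg G then g else commutator_elt G * g.

(* [inl g] is the element g of G, and [inr g] is the element gu of Gu. *)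
Definition Mloop (G : groupType) (go : G) : Type := (G + G)%type.

Definition Mloop_mul (G : groupType) (go : G) (a b : Mloop go) : Mloop go :=
  match a, b with
  | inl g, inl h => inl (g * h)
  | inl g, inr h => inr (h * g)
  | inr g, inl h => inr (g * starg h)
  | inr g, inr h => inl (go * starg h * g)
  end.

HB.instance Definition _ (G : groupType) (go : G) :=
  hasMul.Build (Mloop go) (@Mloop_mul G go).

Definition is_loop (L : magmaType) : Prop :=
  [/\ exists e : L, forall a, e * a = a /\ a * e = a,
      forall a c : L, exists! b, a * b = c
    & forall b c : L, exists! a, a * b = c].

Lemma centerg_subgroup (G : groupType) : subgroup (centerg G).
Proof.
split=> [g|g h Zg Zh k|g Zg k]; first by rewrite /commute mul1g mulg1.
  by rewrite /commute -mulgA (Zh k) mulgA (Zg k) mulgA.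
by apply/commute_sym/commuteV/commute_sym; apply: Zg.
Qed.

Lemma quotient_center_hom (G H : groupType) :
  quotient_isog (centerg G) H ->
  exists f : G -> H, [/\ {morph f : g h / g * h},
    forall h, exists g, f g = h & forall g, f g = 1 <-> centerg G g].
Proof.
have [Z1 ZM ZV] := @centerg_subgroup G.
case=> phi [[_ phiI phiS] phiM].
exists (fun g => phi (coset_set (centerg G) g)); split=> [//|h|g].
- by have [_ [g _ <-] <-] := phiS h I; exists g.
have phi1 : phi (coset_set (centerg G) 1) = 1.
  by apply: (mulgI (phi (coset_set (centerg G) 1))); rewrite -phiM !mulg1.
split=> [|Zg].
  rewrite -phi1 => /phiI eqC.
  have: coset_set (centerg G) g g by exists 1; rewrite // mulg1.
  rewrite eqC; first by case=> z Zz <-; rewrite mul1g.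
  - by apply/mem_set; exists g.
  - by apply/mem_set; exists 1.
rewrite -[RHS]phi1; congr phi; apply/seteqP; split=> _ [z Zz <-].
  by exists (g * z); [exact: ZM | rewrite mul1g].
by exists (g^-1 * z); [apply: ZM => //; exact: ZV | rewrite mulVKg mul1g].
Qed.

Lemma commutator_eltP (G : groupType) : central_quotient_klein G ->
  let s := commutator_elt G in
  [/\ commutator_subgroup G = [set 1; s], has_order s 2 & centerg G s].
Proof.
have [Z1 ZM ZV] := @centerg_subgroup G.
move=> /quotient_center_hom [f [fM fS fZ]] s.
pose u : 'Z_2 := inZp 1; pose o : 'Z_2 := inZp 0.
have [a fa] := fS (u, o); have [b fb] := fS (o, u).
have fC g h : f g * f h = f h * f g.
  by case: (f g) (f h) => [x1 x2] [y1 y2]; congr pair; apply: Zp_addC.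
have f1 : f 1 = 1 by exact/(fZ 1).
have fV g : f g^-1 = (f g)^-1.
  by apply: (mulgI (f g)); rewrite -fM !mulgV.
have fE g : [\/ f g = 1, f g = f a, f g = f b | f g = f (a * b)].
  rewrite fM fa fb; case: (f g) => [[[|[|//]] i] [[|[|//]] j]].
  - by apply: Or41; congr pair; apply: val_inj.
  - by apply: Or43; congr pair; apply: val_inj.
  - by apply: Or42; congr pair; apply: val_inj.
  - by apply: Or44; congr pair; apply: val_inj.
have Zcomm (g h : G) : centerg G [~ g, h].
  by apply/fZ; rewrite !fM !fV [f g * _]fC mulKg mulVg.
have comm_cent (z k : G) : centerg G z -> [~ z, k] = 1.
  by move=> Zz; apply/eqP/commgP.
have commM (g h k : G) : [~ g * h, k] = [~ g, k] * [~ h, k].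
  have <- : [~ g, k] * (h^-1 * h ^ k) = [~ g * h, k].
    rewrite mulgA (Zcomm g k) [in RHS]commgEl conjMg invgM.
    by rewrite -[RHS]mulgA [g^-1 * (_ * _)]mulgA mulgA.
  by [].
have commE (g h k : G) : f g = f h -> [~ g, k] = [~ h, k].
  move=> e; rewrite -[g](mulVKg h) commM [[~ h^-1 * g, k]]comm_cent ?mulg1 //.
  by apply/fZ; rewrite fM fV e mulVg.
pose c := [~ a, b].
have cc : c * c = 1.
  rewrite -commM comm_cent //; apply/fZ; rewrite fM fa.
  by congr pair; apply: val_inj.
have cV : c^-1 = c by apply: mulg1_eq.
pose S := [set 1; c].
have SM g h : S g -> S h -> S (g * h).
  by move=> [->|->] [->|->]; rewrite /S /= ?mul1g ?mulg1 ?cc; [left|right|right|left].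
have SV g : S g -> S g^-1.
  by move=> [->|->]; rewrite /S /= ?invg1 ?cV; [left|right].
have Sgen (k : G) : S [~ a, k] -> S [~ b, k] -> forall g : G, S [~ g, k].
  move=> Sa Sb g; case: (fE g) => [e1|/commE->|/commE->|/commE->] //.
    by left; apply/comm_cent/fZ.
  by rewrite commM; apply: SM.
have Scomm (g h : G) : S [~ g, h].
  have Sa k : S [~ a, k].
    rewrite -invgR; apply/SV/Sgen; first by left; rewrite commgg.
    by rewrite -invgR; apply: SV; right.
  have Sb k : S [~ b, k].
    rewrite -invgR; apply/SV/Sgen; first by right.
    by left; rewrite commgg.
  exact: Sgen.
have GE : commutator_subgroup G = S.
  apply/seteqP; split.
    by apply: smallest_sub => [|_ [g [h ->]] //]; split=> //; left.
  move=> _ [->|->] B [[B1 _ _] sB]; first exact: B1.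
  by apply: sB; exists a, b.
have es : s = c.
  rewrite /s /commutator_elt; apply: xget_unique => [|t /= et]; first exact: GE.
  have: [set 1; t] c by rewrite -et GE; right.
  case=> // c1; have: S t by rewrite -GE et; right.
  by case=> ->.
rewrite es; split; [exact: GE | | exact: Zcomm].
split=> // -[|[|//]] // _; rewrite expg1 => c1.
have: f a = 1.
  apply/fZ => h; apply/commgP/eqP.
  by have [] := Scomm a h => // ->.
by rewrite fa => -[].
Qed.

Lemma Mloop_is_loop (G : groupType) (go : G) :
  central_quotient_klein G -> is_loop (Mloop go).
Proof.
move=> /commutator_eltP[_ [_ ss _] Zs].
have [Z1 ZM ZV] := @centerg_subgroup G.
have starK : involutive (@starg G).
  move=> g; rewrite {2}/starg; case: ifPn => [Zg|gNZ]; first by rewrite /starg Zg.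
  rewrite /starg ifF ?mulgA -?expg2 ?ss ?mul1g //; apply: contraNF gNZ.
  move=> /set_mem Zsg; apply/mem_set.
  by rewrite -[g](mulKg (commutator_elt G)); apply: ZM => //; apply: ZV.
have star1 : @starg G 1 = 1 by rewrite /starg ifT //; apply/mem_set.
split.
- exists (inl 1); case=> g; split; rewrite /mul /= /Mloop_mul ?star1 ?mul1g ?mulg1 //.
- case=> [g|g] [h|h].
  + exists (inl (g^-1 * h)); split; first by congr inl; rewrite mulVKg.
    by case=> k // [<-]; rewrite mulKg.
  + exists (inr (h * g^-1)); split; first by congr inr; rewrite mulgVK.
    by case=> k // [<-]; rewrite mulgK.
  + exists (inr (starg (go^-1 * (h * g^-1)))); split.
      by congr inl; rewrite starK mulVKg mulgVK.
    by case=> k // [<-]; rewrite mulgK mulKg starK.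
  + exists (inl (starg (g^-1 * h))); split.
      by congr inr; rewrite starK mulVKg.
    by case=> k // [<-]; rewrite mulKg starK.
- case=> [g|g] [h|h].
  + exists (inl (h * g^-1)); split; first by congr inl; rewrite mulgVK.
    by case=> k // [<-]; rewrite mulgK.
  + exists (inr (h * (starg g)^-1)); split; first by congr inr; rewrite mulgVK.
    by case=> k // [<-]; rewrite mulgK.
  + exists (inr ((go * starg g)^-1 * h)); split; first by congr inl; rewrite mulVKg.
    by case=> k // [<-]; rewrite mulKg.
  + exists (inl (g^-1 * h)); split; first by congr inr; rewrite mulVKg.
    by case=> k // [<-]; rewrite mulKg.
Qed.

Definition isomorphic (L1 L2 : magmaType) : Prop :=
  exists f : {multiplicative L1 -> L2}, bijective f.

Definition D_axioms (D : groupType) (x y t1 : D) (m1 : nat) : Prop :=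
  [/\ central_quotient_klein D,
      generated ([set x; y] `|` centerg D) = [set: D],
      0 < m1,
      has_order t1 (2 ^ m1)
    & [~ x, y] = t1 ^+ (2 ^ m1.-1)].

Definition has_2power_order (D : groupType) (t : D) (m : nat) : Prop :=
  0 < m /\ has_order t (2 ^ m).

Definition cyclic_generator (C : groupType) (t : C) : Prop :=
  generated [set t] = [set: C].

Inductive loop_of_type : nat -> magmaType -> Prop :=
| Type1 (D : groupType) (x y t1 : D) (m1 : nat) of
    D_axioms x y t1 m1 &
    is_cyclic_dprod [:: t1] (centerg D) &
    x ^+ 2 = 1 & y ^+ 2 = 1 :
    loop_of_type 1 (@Mloop D 1)
| Type2 (D : groupType) (x y t1 : D) (m1 : nat) of
    D_axioms x y t1 m1 &
    is_cyclic_dprod [:: t1] (centerg D) &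
    x ^+ 2 = t1 & y ^+ 2 = t1 :
    loop_of_type 2 (@Mloop D t1)
| Type3 (D : groupType) (x y t1 t2 : D) (m1 m2 : nat) of
    D_axioms x y t1 m1 & has_2power_order t2 m2 &
    is_cyclic_dprod [:: t1; t2] (centerg D) &
    x ^+ 2 = 1 & y ^+ 2 = t2 :
    loop_of_type 3 (@Mloop D 1)
| Type4 (D : groupType) (x y t1 t2 : D) (m1 m2 : nat) of
    D_axioms x y t1 m1 & has_2power_order t2 m2 &
    is_cyclic_dprod [:: t1; t2] (centerg D) &
    x ^+ 2 = t1 & y ^+ 2 = t2 :
    loop_of_type 4 (@Mloop D t1)
| Type5 (D : groupType) (x y t1 u1 : D) (m1 : nat) of
    D_axioms x y t1 m1 & has_infinite_order u1 &
    is_cyclic_dprod [:: t1; u1] (centerg D) &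
    x ^+ 2 = 1 & y ^+ 2 = u1 :
    loop_of_type 5 (@Mloop D 1)
| Type6 (D : groupType) (x y t1 u1 : D) (m1 : nat) of
    D_axioms x y t1 m1 & has_infinite_order u1 &
    is_cyclic_dprod [:: t1; u1] (centerg D) &
    x ^+ 2 = t1 & y ^+ 2 = u1 :
    loop_of_type 6 (@Mloop D t1)
| Type7 (D : groupType) (x y t1 t2 t3 : D) (m1 m2 m3 : nat) of
    D_axioms x y t1 m1 & has_2power_order t2 m2 & has_2power_order t3 m3 &
    is_cyclic_dprod [:: t1; t2; t3] (centerg D) &
    x ^+ 2 = t2 & y ^+ 2 = t3 :
    loop_of_type 7 (@Mloop D 1)
| Type8 (D : groupType) (x y t1 t2 t3 : D) (m1 m2 m3 : nat) of
    D_axioms x y t1 m1 & has_2power_order t2 m2 & has_2power_order t3 m3 &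
    is_cyclic_dprod [:: t1; t2; t3] (centerg D) &
    x ^+ 2 = t2 & y ^+ 2 = t3 :
    loop_of_type 8 (@Mloop D t1)
| Type9 (D : groupType) (x y t1 t2 t3 : D) (m1 m2 m3 : nat)
    (C : groupType) (t : C) (k : nat) of
    D_axioms x y t1 m1 & has_2power_order t2 m2 & has_2power_order t3 m3 &
    is_cyclic_dprod [:: t1; t2; t3] (centerg D) &
    x ^+ 2 = t2 & y ^+ 2 = t3 &
    cyclic_generator t & has_2power_order t k :
    loop_of_type 9 (@Mloop (D * C)%type (1, t))
| Type10 (D : groupType) (x y t1 t2 u1 : D) (m1 m2 : nat) of
    D_axioms x y t1 m1 & has_2power_order t2 m2 & has_infinite_order u1 &
    is_cyclic_dprod [:: t1; t2; u1] (centerg D) &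
    x ^+ 2 = t2 & y ^+ 2 = u1 :
    loop_of_type 10 (@Mloop D 1)
| Type11 (D : groupType) (x y t1 t2 u1 : D) (m1 m2 : nat) of
    D_axioms x y t1 m1 & has_2power_order t2 m2 & has_infinite_order u1 &
    is_cyclic_dprod [:: t1; t2; u1] (centerg D) &
    x ^+ 2 = t2 & y ^+ 2 = u1 :
    loop_of_type 11 (@Mloop D t1)
| Type12 (D : groupType) (x y t1 t2 u1 : D) (m1 m2 : nat)
    (C : groupType) (t : C) (k : nat) of
    D_axioms x y t1 m1 & has_2power_order t2 m2 & has_infinite_order u1 &
    is_cyclic_dprod [:: t1; t2; u1] (centerg D) &
    x ^+ 2 = t2 & y ^+ 2 = u1 &
    cyclic_generator t & has_2power_order t k :
    loop_of_type 12 (@Mloop (D * C)%type (1, t))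
| Type13 (D : groupType) (x y t1 t2 u1 : D) (m1 m2 : nat)
    (C : groupType) (w : C) of
    D_axioms x y t1 m1 & has_2power_order t2 m2 & has_infinite_order u1 &
    is_cyclic_dprod [:: t1; t2; u1] (centerg D) &
    x ^+ 2 = t2 & y ^+ 2 = u1 &
    cyclic_generator w & has_infinite_order w :
    loop_of_type 13 (@Mloop (D * C)%type (1, w))
| Type14 (D : groupType) (x y t1 u1 u2 : D) (m1 : nat) of
    D_axioms x y t1 m1 & has_infinite_order u1 & has_infinite_order u2 &
    is_cyclic_dprod [:: t1; u1; u2] (centerg D) &
    x ^+ 2 = u1 & y ^+ 2 = u2 :
    loop_of_type 14 (@Mloop D 1)
| Type15 (D : groupType) (x y t1 u1 u2 : D) (m1 : nat) of
    D_axioms x y t1 m1 & has_infinite_order u1 & has_infinite_order u2 &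
    is_cyclic_dprod [:: t1; u1; u2] (centerg D) &
    x ^+ 2 = u1 & y ^+ 2 = u2 :
    loop_of_type 15 (@Mloop D t1)
| Type16 (D : groupType) (x y t1 u1 u2 : D) (m1 : nat)
    (C : groupType) (w : C) of
    D_axioms x y t1 m1 & has_infinite_order u1 & has_infinite_order u2 &
    is_cyclic_dprod [:: t1; u1; u2] (centerg D) &
    x ^+ 2 = u1 & y ^+ 2 = u2 &
    cyclic_generator w & has_infinite_order w :
    loop_of_type 16 (@Mloop (D * C)%type (1, w)).

(* Main.v *)
Require Import Defs.
From HB Require Import structures.
From mathcomp Require Import all_boot.
From mathcomp Require Import zmodp boolp classical_sets functions.

Set Implicit Arguments.
Unset Strict Implicit.
Unset Printing Implicit Defensive.

Import Algebra.

Local Open Scope classical_set_scope.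
Local Open Scope group_scope.

(** The multiplication of L = M(G,*,g_o) lets us read off the group Z(G): since
    s <> 1, the elements of L that commute with every element are exactly the
    elements of Z(G).  Call this set Z.  Any isomorphism of loops therefore
    preserves

    - the number of z in Z with z^2 = 1, which is 2^n when Z is a direct product
      of cyclic groups of 2-power or infinite order, n of them finite;
    - the number of classes of Z modulo squares of elements of Z, which is 2^k
      for k cyclic factors;
    - the number of cosets aZ, with a outside Z, such that a^2 is the square of
      an element of Z.  Since (az)^2 = a^2 z^2 for z in Z, this is a property of
      the coset; L/Z is elementary abelian of order 8, so there are seven
      nontrivial cosets.

    The pair (n,k) differs for any two of the sixteen types, except inside the
    pairs 1-2, 3-4, 5-6, 7-8, 10-11, 14-15, where the two groups have the same
    shape and only x^2, y^2 and g_o change.  There the third number decides.  In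
    the first type of a pair u squares to 1, and so do x when x^2 = 1 (types 1,
    3 and 5) and moreover y and (xy)u in type 1, which gives at least 4, 2, 2, 1,
    1, 1 cosets.  For the second type, every homomorphism chi : Z -> Z/2Z kills
    the squares of elements of Z; evaluating the characters chi_i, where chi_i
    is the parity of the exponent of the i-th generator, on the squares of the
    seven coset representatives leaves at most 3, 1, 1, 0, 0, 0 cosets.  The exact number in
    a type may depend on whether s is a square in Z, that is on m_1, but these
    bounds do not.

    [parity_characters] and [dprod_involutions] treat the group Z,
    [commutant_Mloop] identifies it inside L, [at_least_roots] and
    [at_most_roots] count cosets, and [profile_leq] is the invariance. *)
(** * Cyclic groups and their internal direct products *)

(** [N = 0] encodes infinite order, because [0 %| d] only for [d = 0]; elements
    of even and of infinite order can so be treated together. *)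
Definition period (G : groupType) (t : G) (N : nat) : Prop :=
  forall d, t ^+ d = 1 <-> N %| d.

Definition even_period (G : groupType) (t : G) : Prop :=
  exists h, period t h.*2.

Section Cyclic.
Variable G : groupType.
Implicit Types (t a b c : G) (A B Z : set G).

Lemma has_order_period t n : has_order t n -> period t n.
Proof.
case=> n_gt0 tn tmin d; split=> [td|/dvdnP[q ->]]; last first.
  by rewrite mulnC expgnA tn expg1n.
rewrite /dvdn; case: (posnP (d %% n)) => [//|r_gt0].
case: (tmin (d %% n)); first by rewrite r_gt0 ltn_mod.
by move: td; rewrite {1}(divn_eq d n) expgnDr mulnC expgnA tn expg1n mul1g.
Qed.

Lemma has_2power_order_period t m :
  0 < m -> has_order t (2 ^ m) -> period t (2 ^ m.-1).*2.
Proof. by case: m => // m _ /has_order_period; rewrite expnS mul2n. Qed.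

Lemma has_infinite_order_period t : has_infinite_order t -> period t 0.
Proof.
move=> tinf [|d]; first by rewrite expg0.
by rewrite dvd0n; split=> // td; case: (tinf d.+1).
Qed.

Lemma period_expg_eq t N i j :
  period t N -> t ^+ i = t ^+ j -> i = j %[mod N].
Proof.
move=> tN; wlog le_ji : i j / j <= i.
  move=> H; case: (leqP j i) => [|/ltnW]; first exact: H.
  by move=> /H H' /esym /H' ->.
move=> eq_ij; apply/eqP; rewrite eqn_mod_dvd //; apply/tN.
by rewrite expgnFr // eq_ij mulgV.
Qed.

Lemma subgroup_generated A : subgroup (generated A).
Proof.
split=> [B [[]] //|g h gA hA B BA|g gA B BA].
  by have [[_ BM _] _] := BA; apply: BM; [apply: gA|apply: hA].
by have [[_ _ BV] _] := BA; apply: BV; apply: gA.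
Qed.

Lemma generated1P t a :
  generated [set t] a <-> exists i j, a = t ^+ i / t ^+ j.
Proof.
have tC i j : commute (t ^+ i) (t ^+ j) by apply: commuteX2; apply: commute_refl.
split; last first.
  have [s1 sM sV] := subgroup_generated [set t].
  have st : generated [set t] t by move=> B [_ tB]; apply: tB.
  have sX i : generated [set t] (t ^+ i).
    by elim: i => [|i IHi]; [exact: s1 | rewrite expgS; exact: sM].
  by case=> i [j ->]; apply: sM; [|apply: sV].
apply: (@smallest_sub _ _ _ [set a | exists i j, a = t ^+ i / t ^+ j]).
  split=> [|_ _ [i [j ->]] [k [l ->]]|_ [i [j ->]]].
  - by exists 0%N, 0%N; rewrite mulgV.
  - exists (i + k), (l + j); rewrite !expgnDr invgM !mulgA; congr (_ / _).
    by rewrite -!mulgA; congr (_ * _); apply/commute_sym/commuteV/tC.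
  - by exists j, i; rewrite invgM invgK.
by move=> _ ->; exists 1%N, 0%N; rewrite invg1 mulg1.
Qed.

Lemma generated1_abelian t a b :
  generated [set t] a -> generated [set t] b -> commute a b.
Proof.
have tC i j : commute (t ^+ i) (t ^+ j) by apply: commuteX2; apply: commute_refl.
move=> /generated1P[i [j ->]] /generated1P[k [l ->]].
apply: commuteM; last apply: commuteV.
all: by apply: commute_sym; apply: commuteM; last apply: commuteV.
Qed.

Lemma generated1_id t : generated [set t] t.
Proof. by move=> B [_ tB]; apply: tB. Qed.

(** The squares have index at most 2 in a cyclic group: t^i t^-j is
    t^(i+j) t^(-2j), so only the parity of i + j matters. *)
Lemma cyclic_square_cases t a : generated [set t] a ->
  exists2 c, generated [set t] c & a = c ^+ 2 \/ a = t * c ^+ 2.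
Proof.
move=> /generated1P[i [j ->]].
have tC k l : commute (t ^+ k) (t ^+ l) by apply: commuteX2; apply: commute_refl.
exists (t ^+ (i + j)./2 / t ^+ j).
  by apply/generated1P; exists (i + j)./2, j.
have -> : (t ^+ (i + j)./2 / t ^+ j) ^+ 2 = t ^+ (i + j)./2.*2 / t ^+ (j + j).
  by rewrite expgnFl // -!expgnA !muln2 addnn.
have -> : t ^+ i / t ^+ j = t ^+ (i + j) / t ^+ (j + j).
  by rewrite !expgnDr invgM !mulgA mulgK.
rewrite -{1 3}(odd_double_half (i + j)).
case: (odd _); [right|left]; last by rewrite add0n.
by rewrite expgnDr expg1 -mulgA.
Qed.

(** Otherwise some odd power of [t] would be an even power of [t], against the
    even (or infinite) order. *)
Lemma cyclic_nonsquare t c : even_period t ->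
  generated [set t] c -> c ^+ 2 <> t.
Proof.
move=> [h th] /generated1P[i [j ->]].
have tC k l : commute (t ^+ k) (t ^+ l) by apply: commuteX2; apply: commute_refl.
rewrite expgnFl // -!expgnA => /(canRL (mulgVK _)); rewrite -expgS.
move=> /(period_expg_eq th) /(congr1 (modn^~ 2)).
by rewrite !modn_dvdm ?modn2 -?muln2 ?dvdn_mull // /= !oddM !andbF.
Qed.

(** In the infinite case [h] is 0 and both alternatives are the identity. *)
Lemma cyclic_involutions t h c : period t h.*2 ->
  generated [set t] c -> c ^+ 2 = 1 -> c = 1 \/ c = t ^+ h.
Proof.
move=> th /generated1P[i [j cE]] c2.
have th2 : t ^+ h ^+ 2 = 1 by rewrite -expgnA muln2; apply/th.
suff [d cd] : exists d, c = t ^+ d.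
  have : h.*2 %| d * 2 by apply/th; rewrite expgnA -cd.
  rewrite muln2 -!mul2n dvdn_pmul2l // => /dvdnP[q dq].
  rewrite cd dq mulnC expgnA -(odd_double_half q) expgnDr -mul2n expgnA th2.
  by rewrite expg1n mulg1; case: (odd q); [right|left].
case: (leqP j i) => [le_ji|/ltnW le_ij].
  by exists (i - j); rewrite expgnFr.
exists (j - i); rewrite expgnFr //.
(* If i < j, the same works for c^-1, which is c. *)
have <- : c^-1 = c by apply: mulg1_eq; rewrite -expg2.
by rewrite cE invgM invgK.
Qed.

Definition nonsquare_in A a : bool :=
  ~~ `[< exists2 c, A c & a = c ^+ 2 >].

(** The parity of an exponent of [t], defined without choosing the exponent as
    the property of not being a square. *)
Lemma parity_cyclic t : even_period t ->
  exists2 chi : G -> bool,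
    chi t /\ (forall a b, generated [set t] a -> generated [set t] b ->
              chi (a * b) = chi a (+) chi b)
  & forall a, generated [set t] a -> ~~ chi a ->
      exists2 c, generated [set t] c & a = c ^+ 2.
Proof.
move=> te; set T := generated [set t].
have [T1 TM TV] := subgroup_generated [set t].
have TC := @generated1_abelian t; have Tt := @generated1_id t.
have sqP a c : T c -> a = c ^+ 2 -> nonsquare_in T a = false.
  by move=> Tc ac; apply/negbTE; rewrite negbK; apply/asboolP; exists c.
have nsqP a c : T c -> a = t * c ^+ 2 -> nonsquare_in T a.
  move=> Tc ->; apply/asboolP => -[d Td] /(canRL (mulgK _)) tE.
  have := @cyclic_nonsquare t (d / c) te; rewrite expgnFl; last exact: TC.
  by case=> //; apply: TM => //; apply: TV.
exists (nonsquare_in T); first split.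
- by apply: (nsqP _ 1) => //; rewrite expg1n mulg1.
- move=> a b /cyclic_square_cases[c Tc aE] /cyclic_square_cases[d Td bE].
  have cdE : (c * d) ^+ 2 = c ^+ 2 * d ^+ 2 by apply/expgMn/TC.
  have Tcd := TM _ _ Tc Td.
  have c2t : t * c ^+ 2 = c ^+ 2 * t by apply/TC => //; exact: TM.
  case: aE => ->; case: bE => ->.
  + by rewrite !(sqP (_ ^+ 2) _ _ erefl) // -cdE (sqP _ _ Tcd).
  + rewrite (sqP (c ^+ 2) c) // (nsqP (t * d ^+ 2) d) //.
    rewrite (nsqP (c ^+ 2 * (t * d ^+ 2)) (c * d)) //.
    by rewrite mulgA -c2t -mulgA cdE.
  + rewrite (sqP (d ^+ 2) d) // (nsqP (t * c ^+ 2) c) //.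
    rewrite (nsqP (t * c ^+ 2 * d ^+ 2) (c * d)) //.
    by rewrite cdE -mulgA.
  + rewrite (nsqP (t * c ^+ 2) c) // (nsqP (t * d ^+ 2) d) //.
    rewrite (sqP _ (t * (c * d))) //.
      exact: TM.
    rewrite expgMn ?cdE; last exact: TC.
    have aux u v : t * u = u * t -> t * u * (t * v) = t * t * (u * v).
      by move=> tu; rewrite !mulgA -(mulgA t u t) -tu !mulgA.
    exact: aux.
by move=> a _; rewrite negbK => /asboolP.
Qed.

Lemma dprod_projections A B Z : subgroup A -> subgroup B -> is_dprod A B Z ->
  exists p : G -> G * G, forall a b, A a -> B b -> p (a * b) = (a, b).
Proof.
move=> [A1 AM AV] [B1 BM BV] [_ AB1 _].
exists (fun z => xget (1, 1) [set ab | [/\ A ab.1, B ab.2 & z = ab.1 * ab.2]]).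
move=> a b Aa Bb; apply: xget_unique; first by split.
case=> a' b' /= [Aa' Bb' ab].
have ab' : a'^-1 * a = b' / b.
  by apply: (canRL (mulgK _)); rewrite -mulgA ab mulKg.
have : (A `&` B) (a'^-1 * a).
  split; first by apply: AM => //; apply: AV.
  by rewrite ab'; apply: BM => //; apply: BV.
rewrite AB1 /= => e; have := ab'; rewrite e => /esym e'.
by rewrite -(mulgVK b b') e' mul1g -(mulVKg a' a) e mulg1.
Qed.

Lemma cyclic_dprod_abelian ts Z : is_cyclic_dprod ts Z ->
  subgroup Z /\ (forall a b, Z a -> Z b -> commute a b).
Proof.
elim: ts Z => [|t ts IHts] Z /=.
  move=> ->; split; last by move=> a b -> ->.
  by split=> [//|a b -> ->|a ->]; rewrite ?mulg1 ?invg1.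
move=> [B /IHts[[B1 BM BV] BC] [-> _ TB]].
have [T1 TM TV] := subgroup_generated [set t].
have TC := @generated1_abelian t.
split; first split.
- by exists 1, 1; rewrite mulg1.
- move=> _ _ [a [b [Ta Bb ->]]] [c [d [Tc Bd ->]]].
  exists (a * c), (b * d); split; [exact: TM|exact: BM|].
  by rewrite -!mulgA; congr (_ * _); rewrite !mulgA (TB c b).
- move=> _ [a [b [Ta Bb ->]]]; exists a^-1, b^-1.
  by split; [exact: TV|exact: BV|rewrite TB // invgM].
move=> _ _ [a [b [Ta Bb ->]]] [c [d [Tc Bd ->]]].
apply: commuteM; apply: commute_sym; apply: commuteM.
- exact: TC.
- exact: TB.
- exact/commute_sym/TB.
- exact: BC.
Qed.

Lemma cyclic_dprod_mem ts Z t : is_cyclic_dprod ts Z -> t \in ts -> Z t.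
Proof.
elim: ts Z => [|t' ts IHts] Z //= [B tsB [-> _ _]]; rewrite inE.
have [[B1 _ _] _] := cyclic_dprod_abelian tsB.
case/orP => [/eqP ->|/(IHts _ tsB) Bt].
  by exists t', 1; rewrite mulg1; split=> //; apply: generated1_id.
by exists 1, t; rewrite mul1g; split=> //; have [] := subgroup_generated [set t'].
Qed.

(** [chi i] is the parity of the exponent of the i-th generator, read as a
    homomorphism to Z/2Z; the last two clauses say that the [chi i] together
    identify Z modulo squares with (Z/2Z)^k. *)
Lemma parity_characters ts Z :
  is_cyclic_dprod ts Z -> {in ts, forall t, even_period t} ->
  exists chi : nat -> G -> bool,
  [/\ forall i a b, Z a -> Z b -> chi i (a * b) = chi i a (+) chi i b,
      forall i j, i < size ts -> j < size ts -> chi i (nth 1 ts j) = (i == j),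
      forall a, Z a -> (forall i, i < size ts -> ~~ chi i a) ->
        exists2 c, Z c & a = c ^+ 2
    & forall e : nat -> bool,
        exists2 a, Z a & forall i, i < size ts -> chi i a = e i].
Proof.
elim: ts Z => [|t ts IHts] Z.
  move=> /= -> _; exists (fun _ _ => false); split=> //.
    by move=> a -> _; exists 1; rewrite ?expg1n.
  by move=> e; exists 1.
move=> tsZ ts_even; have [ZG ZC] := cyclic_dprod_abelian tsZ.
case: tsZ => B tsB ZE.
have [|chi [chiM chi_t chiK chiS]] := IHts B tsB.
  by move=> u u_ts; apply: ts_even; rewrite inE u_ts orbT.
have [BG BC] := cyclic_dprod_abelian tsB.
have [theta [theta_t thetaM] thetaK] := parity_cyclic (ts_even t (mem_head _ _)).
have TG := subgroup_generated [set t].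
have [p pE] := dprod_projections TG BG ZE.
case: ZE => ZE _ TB.
have [[T1 TM TV] [B1 BM BV]] := (TG, BG).
have theta1 : theta 1 = false.
  by have := thetaM 1 1 T1 T1; rewrite mulg1; case: (theta 1).
have chi1 i : chi i 1 = false.
  by have := chiM i 1 1 B1 B1; rewrite mulg1; case: (chi i).
(* The character of the first factor is composed with the projection to it, the
   others with the projection to the remaining factors. *)
pose f i a := if i is i'.+1 then chi i' (p a).2 else theta (p a).1.
exists f; split.
- rewrite ZE => i _ _ [a [b [Ta Bb ->]]] [c [d [Tc Bd ->]]].
  have -> : a * b * (c * d) = (a * c) * (b * d).
    by rewrite -!mulgA; congr (_ * _); rewrite !mulgA (TB c b).
  rewrite /f !pE //; [|exact: TM|exact: BM].
  by case: i => [|i]; [exact: thetaM | exact: chiM].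
- move=> [|i] [|j] //= lti ltj.
  + by rewrite -[t]mulg1 pE //; apply: generated1_id.
  + rewrite -[nth _ _ _]mul1g pE //.
    by apply: (cyclic_dprod_mem tsB); rewrite mem_nth.
  + by rewrite -[t]mulg1 pE //; apply: generated1_id.
  + rewrite -[nth _ _ _]mul1g pE ?chi_t //.
    by apply: (cyclic_dprod_mem tsB); rewrite mem_nth.
- rewrite ZE => _ [a [b [Ta Bb ->]]] chi0.
  have := chi0 0 isT; rewrite /f pE // => /(thetaK _ Ta)[c Tc ->].
  have [|d Bd ->] := chiK _ Bb.
    by move=> i lti; have := chi0 i.+1 lti; rewrite /f pE.
  exists (c * d); first by exists c, d.
  by rewrite expgMn //; apply: TB.
move=> e; have [b Bb bE] := chiS (fun i => e i.+1).
have Tc : generated [set t] (if e 0 then t else 1).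
  by case: ifP => // _; apply: generated1_id.
exists ((if e 0 then t else 1) * b).
  by rewrite ZE; exists (if e 0 then t else 1), b.
by move=> [|i] /= lti; rewrite pE //=; [case: (e 0) | apply: bE].
Qed.

(** A cyclic factor of infinite order, for which [th.2] is 0, contributes only
    the identity, and each other factor two elements. *)
Lemma dprod_involutions (ths : seq (G * nat)) Z :
  is_cyclic_dprod (unzip1 ths) Z ->
  {in ths, forall th, period th.1 th.2.*2} ->
  exists s : seq G, [/\ uniq s, size s = (2 ^ count (fun th => 0 < th.2) ths)%N
    & forall a, a \in s <-> Z a /\ a ^+ 2 = 1].
Proof.
elim: ths Z => [|[t h] ths IHths] Z.
  move=> /= -> _; exists [:: 1]; split=> // a; rewrite inE.
  by split=> [/eqP ->|[-> _] //]; rewrite expg1n.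
move=> /= [B tsB ZE] ths_per.
have [|s [s_uniq s_size sP]] := IHths B tsB.
  by move=> u u_ts; apply: ths_per; rewrite inE u_ts orbT.
have th : period t h.*2 by apply: (ths_per (t, h)); rewrite mem_head.
have [BG BC] := cyclic_dprod_abelian tsB.
have TG := subgroup_generated [set t].
have [p pE] := dprod_projections TG BG ZE.
case: ZE => ZE _ TB.
have [[T1 TM TV] [B1 BM BV]] := (TG, BG).
pose r := if 0 < h then [:: 1; t ^+ h] else [:: 1].
have rP c : c \in r <-> generated [set t] c /\ c ^+ 2 = 1.
  split; last first.
    case=> Tc /(cyclic_involutions th Tc) cE; rewrite /r.
    case: posnP cE => [->|_]; rewrite !inE.
      by case=> ->; rewrite ?expg0.
    by case=> ->; rewrite eqxx ?orbT.
  have T1' : generated [set t] 1 /\ 1 ^+ 2 = 1 :> G by rewrite expg1n.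
  move=> c_r; have [->|->] // : c = 1 \/ c = t ^+ h.
    move: c_r; rewrite /r; case: ifP => _; rewrite !inE.
      by case/orP=> /eqP; [left|right].
    by move=> /eqP; left.
  split; first by apply/generated1P; exists h, 0%N; rewrite invg1 mulg1.
  by rewrite -expgnA muln2; apply/th.
have r_uniq : uniq r.
  rewrite /r; case: posnP => //= h_gt0; rewrite inE andbT eq_sym; apply/eqP.
  move=> /th /(dvdn_leq h_gt0); rewrite leqNgt -addnn -{1}[h]addn0.
  by rewrite ltn_add2l h_gt0.
have r_size : size r = (2 ^ (0 < h)%N)%N by rewrite /r; case: ifP.
exists [seq c * b | c <- r, b <- s]; split.
- apply: allpairs_uniq => // -[c b] [c' b'].
  move=> /allpairsP[[c1 b1] [/rP[Tc _] /sP[Bb _] [-> ->]]].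
  move=> /allpairsP[[c2 b2] [/rP[Tc' _] /sP[Bb' _] [-> ->]]] /= cb.
  by rewrite -(pE c1 b1) // cb pE.
- by rewrite size_allpairs r_size s_size -expnD.
move=> a; split=> [/allpairsP[[c b] [/rP[Tc c2] /sP[Bb b2] /= ->]]|].
  split; first by rewrite ZE; exists c, b.
  by rewrite expgMn ?c2 ?b2 ?mulg1 //; apply: TB.
rewrite ZE => -[[c [b [Tc Bb ->]]]]; rewrite expgMn; last exact: TB.
move=> cb2; apply/allpairsP; exists (c, b).
have Tc2 : generated [set t] (c ^+ 2) by exact: TM.
have Bb2 : B (b ^+ 2) by exact: BM.
have [/= c2 b2] : (c ^+ 2, b ^+ 2) = (1, 1).
  by rewrite -(pE _ _ Tc2 Bb2) cb2 -(pE _ _ T1 B1) mulg1.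
by split=> //; [apply/rP|apply/sP].
Qed.

End Cyclic.

(** * Invariants of magmas *)

Section Counting.
Variables (L : Type) (P : set L) (R : L -> L -> Prop).

Definition at_least (N : nat) : Prop :=
  exists f : 'I_N -> L,
    (forall i, P (f i)) /\ (forall i j, R (f i) (f j) -> i = j).

(** Classes are bounded from above through labels instead of representatives:
    in an arbitrary magma the relations counted below may fail to be symmetric
    or transitive. *)
Definition at_most (N : nat) : Prop :=
  exists (T : eqType) (p : L -> T) (s : seq T),
    [/\ size s <= N, forall a, P a -> p a \in s
      & forall a b, P a -> P b -> p a = p b -> R a b].

Lemma at_least_at_most M N : at_least M -> at_most N -> M <= N.
Proof.
case=> f [fP fR] [T [p [s [s_size ps pR]]]].
apply: leq_trans s_size; rewrite -[M]size_enum_ord -(size_map (p \o f)).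
apply: uniq_leq_size => [|_ /mapP[i _ ->]]; last exact/ps/fP.
by rewrite map_inj_uniq ?enum_uniq // => i j /pR H; apply/fR/H.
Qed.

End Counting.

Lemma at_least_image (L1 L2 : Type) (f : L1 -> L2) (P1 : set L1) (P2 : set L2)
    (R1 : L1 -> L1 -> Prop) (R2 : L2 -> L2 -> Prop) (N : nat) :
  (forall a, P1 a -> P2 (f a)) -> (forall a b, R2 (f a) (f b) -> R1 a b) ->
  at_least P1 R1 N -> at_least P2 R2 N.
Proof.
move=> fP fR [h [hP hR]]; exists (f \o h).
by split=> [i|i j /fR /hR]; first exact/fP/hP.
Qed.

Definition commutant (L : magmaType) : set L :=
  [set z | forall a, z * a = a * z].
Arguments commutant L : clear implicits.

(** In a loop, z z z = z says that z z is the identity; this form avoids naming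
    the identity. *)
Definition central_involutions (L : magmaType) : set L :=
  [set z | commutant L z /\ z * z * z = z].

Definition same_square_class (L : magmaType) (a b : L) : Prop :=
  exists2 c, commutant L c & a = b * (c * c).

(** Noncentral elements that become involutions after multiplication by a
    suitable central element. *)
Definition square_roots (L : magmaType) : set L :=
  [set a | ~ commutant L a /\ exists2 c, commutant L c & a * a = c * c].

Definition same_coset (L : magmaType) (a b : L) : Prop :=
  exists2 c, commutant L c & a = b * c.

Arguments central_involutions L : clear implicits.
Arguments square_roots L : clear implicits.

(** The number of cosets of square roots is only bounded: its exact value can
    depend on the order of t_1. *)
Record profile (L : magmaType) (n k lo hi : nat) : Prop := Profile {
  involutions_ge : at_least (central_involutions L) eq (2 ^ n);
  involutions_le : at_most (central_involutions L) eq (2 ^ n);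
  square_classes_ge : at_least (commutant L) (@same_square_class L) (2 ^ k);
  square_classes_le : at_most (commutant L) (@same_square_class L) (2 ^ k);
  roots_ge : at_least (square_roots L) (@same_coset L) lo;
  roots_le : at_most (square_roots L) (@same_coset L) hi }.

(** The three counts are expressed by the multiplication alone, so [f] carries
    a family of inequivalent elements of L1 to one of L2. *)
Lemma profile_leq (L1 L2 : magmaType) (f : L1 -> L2) n1 k1 lo1 hi1 n2 k2 lo2 hi2 :
    {morph f : a b / a * b} -> bijective f ->
  profile L1 n1 k1 lo1 hi1 -> profile L2 n2 k2 lo2 hi2 ->
  [/\ n1 <= n2, k1 <= k2 & lo1 <= hi2].
Proof.
move=> fM [g fK gK] p1 p2.
have f_inj := can_inj fK.
have fZ a : commutant L2 (f a) <-> commutant L1 a.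
  split=> [Za b|Za b]; first by apply: f_inj; rewrite !fM.
  by rewrite -[b]gK -!fM Za.
have fZex (Q : L2 -> Prop) : (exists2 c, commutant L2 c & Q c) ->
    exists2 c, commutant L1 c & Q (f c).
  by case=> c; rewrite -[c]gK => Zc Qc; exists (g c) => //; apply/fZ.
split.
- rewrite -(leq_exp2l _ _ (isT : 1 < 2)).
  apply: at_least_at_most (involutions_le p2).
  apply: (at_least_image (f := f)) (involutions_ge p1) => // a [Za a3].
  by split; [apply/fZ|rewrite -!fM a3].
- rewrite -(leq_exp2l _ _ (isT : 1 < 2)).
  apply: at_least_at_most (square_classes_le p2).
  apply: (at_least_image (f := f)) (square_classes_ge p1) => [a /fZ //|a b].
  by case/fZex=> c Zc; rewrite -!fM => /f_inj; exists c.
- apply: at_least_at_most (roots_le p2).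
  apply: (at_least_image (f := f)) (roots_ge p1) => [a [NZa [c Zc ac]]|a b].
    by split=> [/fZ //|]; exists (f c); [apply/fZ|rewrite -!fM ac].
  by case/fZex=> c Zc; rewrite -!fM => /f_inj; exists c.
Qed.

(** The quotient map G -> C2 x C2 may send x and y to any two distinct nontrivial
    elements; they serve as a basis. *)
Lemma klein_basis (p q : (C2 * C2)%type) : p <> 1 -> q <> 1 -> p <> q ->
  (forall r, exists i j : bool, r = p ^+ i * q ^+ j) /\
  (forall i j i' j' : bool, p ^+ i * q ^+ j = p ^+ i' * q ^+ j' ->
     (i, j) = (i', j')).
Proof.
have red (a b : C2 * C2) : a <> b -> a != b by move/eqP.
move=> /red p1 /red q1 /red pq; split=> [r|i j i' j' /eqP].
  have : [|| r == 1, r == q, r == p | r == p * q].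
    by move: p q r p1 q1 pq => [[[|[|//]] ?] [[|[|//]] ?]]
      [[[|[|//]] ?] [[|[|//]] ?]] [[[|[|//]] ?] [[|[|//]] ?]].
  case/or4P=> /eqP ->.
  - by exists false, false; rewrite !expg0 mulg1.
  - by exists false, true; rewrite expg0 mul1g.
  - by exists true, false; rewrite expg0 mulg1.
  - by exists true, true.
by move: p q p1 q1 pq => [[[|[|//]] ?] [[|[|//]] ?]]
      [[[|[|//]] ?] [[|[|//]] ?]]; case: i j i' j' => [] [] [] [].
Qed.

(** * The loop M(G,*,g_o) *)

Section KleinQuotient.
Variables (G : groupType) (go : G).
Hypothesis kleinG : central_quotient_klein G.
Local Notation L := (Mloop go).
Local Notation Z := (centerg G).
Local Notation il g := (inl g : L).
Local Notation ir g := (inr g : L).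

Lemma starg_central g : Z g -> starg g = g.
Proof. by move=> Zg; rewrite /starg ifT //; apply/mem_set. Qed.

Lemma starg_noncentral g : ~ Z g -> starg g = commutator_elt G * g.
Proof. by move=> NZg; rewrite /starg ifF //; apply/negbTE/negP => /set_mem. Qed.

Lemma commutator_elt_neq1 : commutator_elt G <> 1.
Proof.
have [_ [_ _ s1] _] := commutator_eltP kleinG.
by move=> s_eq1; apply: (s1 1%N).
Qed.

Lemma commutator_eltE x y : ~ commute x y -> [~ x, y] = commutator_elt G.
Proof.
have [GE _ _] := commutator_eltP kleinG => xyNC.
have : commutator_subgroup G [~ x, y] by move=> B [_ sB]; apply: sB; exists x, y.
by rewrite GE => -[/eqP/commgP|].
Qed.

Lemma exists_noncentral : exists g, ~ Z g.
Proof.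
have [f [fM fS fZ]] := quotient_center_hom kleinG.
have [g fg] := fS (inZp 1, inZp 1); exists g => /fZ.
by rewrite fg => -[].
Qed.

(** An element gu commutes with h only if h* = h, which fails for noncentral
    h; likewise g commutes with hu only if g* = g. *)
Lemma commutant_Mloop a : commutant L a <-> exists2 z, Z z & a = il z.
Proof.
split=> [Za|[z Zz ->] [g|g]]; last first.
- by congr inr; rewrite starg_central.
- by congr inl; apply: Zz.
case: a Za => g Zg.
  by exists g => // h; have [] := Zg (inl h).
have [h NZh] := exists_noncentral.
have [] := Zg (inl h); rewrite starg_noncentral // => /mulgI sh.
by case: commutator_elt_neq1; apply: (mulIg h); rewrite mul1g.
Qed.

Lemma involutions_Mloop (ths : seq (G * nat)) :
    is_cyclic_dprod (unzip1 ths) Z ->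
    {in ths, forall th, period th.1 th.2.*2} ->
  let n := count (fun th => 0 < th.2) ths in
  at_least (central_involutions L) eq (2 ^ n) /\
  at_most (central_involutions L) eq (2 ^ n).
Proof.
move=> tsZ ths_per n.
have [s [s_uniq s_size sP]] := dprod_involutions tsZ ths_per.
rewrite -s_size; split.
  exists (fun i => il (nth 1 s i)); split=> [i|i j [] /eqP].
    have /sP[Zz z2] := mem_nth 1 (ltn_ord i).
    split; first by apply/commutant_Mloop; eexists; first exact: Zz.
    by congr inl; rewrite -expg2 z2 mul1g.
  by rewrite nth_uniq // => /eqP /val_inj.
exists (G + G)%type, id, [seq inl z | z <- s]; split=> //.
  by rewrite size_map.
move=> a [/commutant_Mloop[z Zz ->] []] z3; apply/map_f/sP; split=> //.
by apply: (mulIg z); rewrite mul1g.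
Qed.

(** The vector of parities of a central element is a complete invariant of its
    class modulo squares, and takes all values. *)
Lemma square_classes_Mloop (ts : seq G) :
    is_cyclic_dprod ts Z -> {in ts, forall t, even_period t} ->
  at_least (commutant L) (@same_square_class L) (2 ^ size ts) /\
  at_most (commutant L) (@same_square_class L) (2 ^ size ts).
Proof.
move=> tsZ ts_even; have [[Z1 ZM ZV] ZC] := cyclic_dprod_abelian tsZ.
have [chi [chiM _ chiK chiS]] := parity_characters tsZ ts_even.
set k := size ts.
have card_bits : #|{: k.-tuple bool}| = (2 ^ k)%N by rewrite card_tuple card_bool.
rewrite -card_bits; split.
  have [e|f fP] := @choice (k.-tuple bool) G
      (fun e a => Z a /\ forall i, i < k -> chi i a = nth false e i).
    by have [a Za aE] := chiS (nth false e); exists a.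
  exists (fun i => il (f (enum_val i))); split=> [i|i j].
    by apply/commutant_Mloop; exists (f (enum_val i)) => //; case: (fP (enum_val i)).
  case=> _ /commutant_Mloop[c Zc ->] [fE]; apply: enum_val_inj.
  apply: eq_from_tnth => l; rewrite !(tnth_nth false).
  have [[Zi <-] // [Zj <-] //] := (fP (enum_val i), fP (enum_val j)).
  by rewrite fE !chiM ?addbb ?addbF //; apply: ZM.
pose p (a : L) :=
  if a is inl z then [tuple chi i z | i < k] else [tuple false | i < k].
exists (k.-tuple bool), p, (enum {: k.-tuple bool}); split.
- by rewrite cardE.
- by move=> a _; rewrite mem_enum.
move=> _ _ /commutant_Mloop[a Za ->] /commutant_Mloop[b Zb ->] /= abE.
have [|i lti|c Zc cE] := chiK (b^-1 * a); first by apply: ZM => //; apply: ZV.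
  have : chi i a = chi i b.
    by have := congr1 (fun t => tnth t (Ordinal lti)) abE; rewrite !tnth_mktuple.
  rewrite -{1}(mulVKg b a) chiM //; last by apply: ZM => //; apply: ZV.
  by case: (chi i b); case: (chi i _).
exists (il c); first by apply/commutant_Mloop; exists c.
by congr inl; rewrite -expg2 -cE mulVKg.
Qed.

Section Roots.
Variables x y : G.
Hypotheses (xyNC : ~ commute x y) (Zgo : Z go).

(** The triple (i,j,k) stands for the coset of (x^i y^j) u^k. *)
Definition representative (ijk : bool * bool * bool) : L :=
  let: (i, j, k) := ijk in
  if k then inr (x ^+ i * y ^+ j) else inl (x ^+ i * y ^+ j).

(** L/Z(G) is elementary abelian of order 8, with basis the cosets of x, y, u. *)
Lemma coset_map : exists v : L -> (C2 * C2) * bool,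
  [/\ forall a b, same_coset a b <-> v a = v b,
      injective (v \o representative)
    & forall a, exists ijk, v a = v (representative ijk)].
Proof.
have [f [fM fS fZ]] := quotient_center_hom kleinG.
have f1 : f 1 = 1 by apply/fZ => g; rewrite /commute mul1g mulg1.
have fV g : f g^-1 = (f g)^-1 by apply/esym/mulg1_eq; rewrite -fM mulgV.
have fE g h : f g = f h <-> Z (h^-1 * g).
  rewrite -fZ fM fV; split=> [->|/(canRL (mulKg _))]; rewrite ?mulVg //.
  by rewrite invgK mulg1.
have fX g (i : bool) : f (g ^+ i) = f g ^+ i by case: i.
have [|||fgen finj] := @klein_basis (f x) (f y).
- by move/fZ => Zx; apply: xyNC.
- by move/fZ => Zy; apply/xyNC/commute_sym.
- move/fE => Zyx; apply: xyNC; rewrite -(mulVKg y x); apply: commute_sym.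
  by apply: commuteM; [apply: commute_refl|apply/commute_sym].
exists (fun a => match a with inl g => (f g, false) | inr g => (f g, true) end).
split.
- move=> [g|g] [h|h]; split.
  + by case=> _ /commutant_Mloop[c /fZ fc ->] [->]; rewrite fM fc mulg1.
  + move=> [] /fE Zhg; exists (il (h^-1 * g)); last by congr inl; rewrite mulVKg.
    by apply/commutant_Mloop; exists (h^-1 * g).
  + by case=> _ /commutant_Mloop[c Zc ->].
  + by [].
  + by case=> _ /commutant_Mloop[c Zc ->].
  + by [].
  + case=> _ /commutant_Mloop[c Zc ->] [->].
    by rewrite starg_central // fM (fZ c).2 // mulg1.
  + move=> [] /fE Zhg; exists (il (h^-1 * g)).
      by apply/commutant_Mloop; exists (h^-1 * g).
    by congr inr; rewrite starg_central // mulVKg.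
- by move=> [[i j] []] [[i' j'] []] //= [];
    rewrite !fM !fX => /finj [-> ->].
- move=> [g|g]; have [i [j ij]] := fgen (f g).
    by exists (i, j, false); rewrite /= fM !fX ij.
  by exists (i, j, true); rewrite /= fM !fX ij.
Qed.

Lemma at_least_roots (cs : seq (bool * bool * bool)) : uniq cs ->
    {in cs, forall c, ~ commutant L (representative c) /\
       exists2 z, Z z & representative c * representative c = il (z * z)} ->
  at_least (square_roots L) (@same_coset L) (size cs).
Proof.
move=> cs_uniq csP; have [v [vE v_inj _]] := coset_map.
exists (fun i => representative (nth (false, false, false) cs i)); split=> [i|i j].
  have [NZc [z Zz cE]] := csP _ (mem_nth (false, false, false) (ltn_ord i)).
  by split=> //; exists (il z); first by apply/commutant_Mloop; exists z.
by move=> /vE /v_inj /eqP; rewrite nth_uniq // => /eqP /val_inj.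
Qed.

Lemma square_central g : Z (g * g).
Proof.
have [f [fM fS fZ]] := quotient_center_hom kleinG.
apply/fZ; rewrite fM; case: (f g) => [[[|[|//]] i] [[|[|//]] j]];
  by congr pair; apply: val_inj.
Qed.

Lemma commutator_elt_sqr : commutator_elt G * commutator_elt G = 1.
Proof. by have [_ [_ ss _] _] := commutator_eltP kleinG; rewrite -expg2. Qed.

(** Here [y * x] is [x * y] times the commutator, which has order 2. *)
Lemma square_xy : x * y * (x * y) = x * x * (y * y) * commutator_elt G.
Proof.
have [_ _ Zs] := commutator_eltP kleinG.
have yxE : y * x * commutator_elt G = x * y.
  by rewrite -(commutator_eltE xyNC) commgEl conjgE -!mulgA !mulVKg.
have {}yxE : y * x = x * y * commutator_elt G.
  by rewrite -yxE -mulgA commutator_elt_sqr mulg1.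
rewrite -!mulgA; congr (_ * _); rewrite !mulgA yxE -!mulgA.
by do 2!congr (_ * _); apply: Zs.
Qed.

Lemma square_coset b z : Z z -> b * z * (b * z) = b * b * (z * z).
Proof. by move=> Zz; rewrite -!mulgA; congr (_ * _); rewrite !mulgA (Zz b). Qed.

Lemma noncentral_word (i j : bool) z :
  Z z -> Z (x ^+ i * y ^+ j * z) -> ~~ (i || j).
Proof.
have [Z1 ZM ZV] := @centerg_subgroup G; move=> Zz Zg.
have {Zz Zg} : Z (x ^+ i * y ^+ j).
  by rewrite -(mulgK z (_ * _)); apply: ZM => //; apply: ZV.
case: i j => [] [] //; rewrite ?expg0 ?expg1 ?mulg1 ?mul1g => Zg; case: xyNC.
- rewrite -[y](mulKg x); apply: commuteM; last exact/commute_sym.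
  exact/commuteV/commute_refl.
- exact: Zg.
- exact/commute_sym/Zg.
Qed.

(** A character of Z(G) kills the square of a central element, hence also a^2 for
    every square root a.  For a in the coset of (x^i y^j) u^k one has, up to
    squares of Z(G), a^2 = x^2i y^2j s^ij when k = 0, and g_o times s (if i or j
    is nonzero) times this when k = 1; so each character gives one equation
    on (i,j,k). *)
Lemma at_most_roots (cs : seq (bool * bool * bool)) :
    (forall i j k : bool, i || j || k ->
      (forall chi : G -> bool,
        (forall a b, Z a -> Z b -> chi (a * b) = chi a (+) chi b) ->
        (i && chi (x * x)) (+) (j && chi (y * y))
          (+) (i && j && chi (commutator_elt G))
          (+) (k && (chi go (+) (i || j) && chi (commutator_elt G))) = false) ->
      (i, j, k) \in cs) ->
  at_most (square_roots L) (@same_coset L) (size cs).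
Proof.
move=> csP; have [v [vE _ v_surj]] := coset_map.
have [Z1 ZM ZV] := @centerg_subgroup G.
have [_ _ Zs] := commutator_eltP kleinG.
exists ((C2 * C2) * bool)%type, v, [seq v (representative c) | c <- cs].
split=> [|a|a b _ _ /vE //]; first by rewrite size_map.
case=> NZa [_ /commutant_Mloop[d Zd ->] ad].
have [[[i j] k] va] := v_surj a; rewrite va; apply: map_f.
have [_ /commutant_Mloop[z Zz ->] aE] : same_coset a (representative (i, j, k)).
  exact/vE.
pose g := x ^+ i * y ^+ j * z.
have {}aE : a = if k then ir g else il g.
  by rewrite aE /=; case: (k) => //; congr inr; rewrite starg_central.
have Zg : ~~ (i || j) -> Z g.
  by rewrite /g; case: (i) (j) => [] [] //= _; rewrite !expg0 !mul1g.
have NZg : i || j -> ~ Z g.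
  by move=> ij Zg'; move: ij; apply/negP/(noncentral_word Zz).
have ijk : i || j || k.
  case: (boolP (i || j)) => //= /Zg Zg'; case: (boolP k) => //= k0; case: NZa.
  by rewrite aE (negbTE k0); apply/commutant_Mloop; exists g.
apply: csP => // chi chiM.
have chi_sq c : Z c -> chi (c * c) = false by move=> Zc; rewrite chiM ?addbb.
have chi_g : chi (g * g) = (i && chi (x * x)) (+) (j && chi (y * y))
    (+) (i && j && chi (commutator_elt G)).
  have Zx := square_central x; have Zy := square_central y.
  rewrite /g square_coset // chiM //; [|exact: square_central|exact: ZM].
  rewrite (chi_sq z) // addbF; case: (i) (j) => [] [] /=;
    rewrite ?expg0 ?expg1 ?mulg1 ?mul1g ?addbF //.
  + by rewrite square_xy (chiM (x * x * _)) ?(chiM (x * x)) //; exact: ZM.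
  + by rewrite -(mul1g 1) chi_sq.
rewrite -chi_g; clearbody g; case: k aE ijk {va} => aE ijk; last first.
  by move: ad; rewrite aE addbF => -[->]; apply: chi_sq.
move: ad; rewrite aE => -[]; case: (boolP (i || j)) => [ij|ij0].
  rewrite starg_noncentral; last exact: NZg.
  rewrite -!mulgA => e; have := chi_sq d Zd.
  have Zgg := square_central g.
  rewrite -e (chiM go) //; last exact: ZM.
  rewrite (chiM (commutator_elt G)) //=.
  by case: (chi go); case: (chi (commutator_elt G)); case: (chi (g * g)).
rewrite starg_central; last exact: Zg.
rewrite -mulgA => e; have := chi_sq d Zd; rewrite -e chiM ?addbF 1?addbC //.
exact: square_central.
Qed.

End Roots.

End KleinQuotient.

(** * Direct products with an abelian factor *)

Section DirectProduct.
Variables D C : groupType.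
Hypothesis C_abelian : forall a b : C, commute a b.

Lemma centerg_prod :
  centerg (D * C)%type = [set z | centerg D z.1].
Proof.
apply/seteqP; split=> [[d c] Zdc e|[d c] /= Zd [e b]].
  by have [] := Zdc (e, 1).
by congr pair; [apply: Zd|apply: C_abelian].
Qed.

(** The first projection induces a bijection between the cosets of the two
    centers, because the center of the product contains the whole of C. *)
Lemma klein_prod :
  central_quotient_klein D -> central_quotient_klein (D * C)%type.
Proof.
have fst_coset (g : (D * C)%type) :
    fst @` coset_set (centerg (D * C)%type) g = coset_set (centerg D) g.1.
  rewrite centerg_prod; apply/seteqP.
  split=> [_ [_ [[z c] /= Zz <-] <-]|_ [z Zz <-]].
    by exists z.
  by exists (g * (z, 1)) => //; exists (z, 1).
have coset_fst g h : coset_set (centerg D) g.1 = coset_set (centerg D) h.1 ->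
    coset_set (centerg (D * C)%type) g = coset_set (centerg (D * C)%type) h.
  move=> gh; have sub (g' h' : (D * C)%type) :
      coset_set (centerg D) g'.1 = coset_set (centerg D) h'.1 ->
      coset_set (centerg (D * C)%type) g' `<=`
        coset_set (centerg (D * C)%type) h'.
    move=> e _ [[z c] Zz <-]; rewrite centerg_prod in Zz.
    have : coset_set (centerg D) g'.1 (g'.1 * z) by exists z.
    rewrite e => -[z' Zz' zE].
    exists (z', h'.2^-1 * (g'.2 * c)); first by rewrite centerg_prod.
    by congr pair => //=; rewrite mulVKg.
  by apply/seteqP; split; apply: sub.
case=> phi [[_ phiI phiS] phiM].
exists (fun X => phi (fst @` X)); split; last first.
  by move=> g h; rewrite !fst_coset phiM.
split=> [//|X Y|h _].
  move=> /set_mem[g _ <-] /set_mem[h _ <-]; rewrite !fst_coset => /phiI gh.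
  by apply/coset_fst/gh; apply/mem_set; eexists.
have [_ [d _ <-] <-] := phiS h I.
exists (coset_set (centerg (D * C)%type) (d, 1)); last by rewrite fst_coset.
by exists (d, 1).
Qed.

Lemma expg_prod (d : D) (c : C) n : (d, c) ^+ n = (d ^+ n, c ^+ n).
Proof. by elim: n => // n IHn; rewrite !expgS IHn. Qed.

Lemma period_inl (d : D) N : period d N -> period ((d, 1) : (D * C)%type) N.
Proof.
move=> dN n; rewrite expg_prod expg1n; split=> [[/dN //]|/dN -> //].
Qed.

Lemma period_inr (c : C) N : period c N -> period ((1, c) : (D * C)%type) N.
Proof.
move=> cN n; rewrite expg_prod expg1n; split=> [[/cN //]|/cN -> //].
Qed.

Lemma cyclic_dprod_inl (ts : seq D) B : is_cyclic_dprod ts B ->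
  is_cyclic_dprod [seq ((t, 1) : (D * C)%type) | t <- ts]
    [set z | B z.1 /\ z.2 = 1].
Proof.
elim: ts B => [|t ts IHts] B /=.
  move=> ->; apply/seteqP; split=> [[d c] /= [-> ->] //|_ -> //].
case=> B' tsB' [-> tB' tC]; exists [set z | B' z.1 /\ z.2 = 1]; first exact: IHts.
have genE (z : (D * C)%type) :
    generated [set ((t, 1) : (D * C)%type)] z <->
    generated [set t] z.1 /\ z.2 = 1.
  split=> [/generated1P[i [j ->]]|].
    rewrite !expg_prod !expg1n; split; last by rewrite /= mul1g invg1.
    by apply/generated1P; exists i, j.
  case: z => d c /= [/generated1P[i [j ->]] ->].
  apply/generated1P; exists i, j; rewrite !expg_prod !expg1n.
  by congr pair; rewrite /= ?invg1 ?mulg1.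
split.
- apply/seteqP.
  split=> [[d c] /= [[a [b [ta Bb ->]]] ->]|
           _ [a [b [/genE[ta a2] [Bb b2] ->]]]] /=.
    exists (a, 1), (b, 1); split=> //; first exact/genE.
    by congr pair; rewrite mulg1.
  split; first by exists a.1, b.1.
  by rewrite a2 b2 mulg1.
- apply/seteqP; split=> [[d c] [/genE /= [td ->] [Bd _]]|_ ->].
    by have: (generated [set t] `&` B') d by []; rewrite tB' => ->.
  have : (generated [set t] `&` B') 1 by rewrite tB'.
  by case=> t1 B1; split; first exact/genE.
- move=> [a c] [b e] /genE /= [ta ->] [/= Bb ->].
  by congr pair; apply: tC.
Qed.

(** The new generator comes first, so that the case of the remaining ones is
    that of [D] embedded in the product. *)
Lemma cyclic_dprod_prod (ts : seq D) (t : C) :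
  is_cyclic_dprod ts (centerg D) -> cyclic_generator t ->
  is_cyclic_dprod (((1, t) : (D * C)%type) :: [seq (u, 1) | u <- ts])
    (centerg (D * C)%type).
Proof.
move=> tsZ tC; exists [set z | centerg D z.1 /\ z.2 = 1].
  exact: cyclic_dprod_inl.
have genE (z : (D * C)%type) :
    generated [set ((1, t) : (D * C)%type)] z <-> z.1 = 1.
  split=> [/generated1P[i [j ->]]|].
    by rewrite !expg_prod !expg1n /= mul1g invg1.
  case: z => d c /= ->.
  have /generated1P[i [j ->]] : generated [set t] c by rewrite tC.
  apply/generated1P; exists i, j; rewrite !expg_prod !expg1n.
  by congr pair; rewrite /= ?invg1 ?mulg1.
rewrite centerg_prod; split.
- apply/seteqP; split=> [[d c] /= Zd|_ [a [b [/genE a1 [Zb b2] ->]]]].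
    exists (1, c), (d, 1); split=> //; first exact/genE.
    by congr pair; rewrite ?mul1g ?mulg1.
  by rewrite /= a1 mul1g.
- apply/seteqP; split=> [[d c] [/genE /= -> [_ /= ->]] //|_ ->].
  split; first exact/genE.
  by split=> // d; rewrite /commute mul1g mulg1.
- move=> [a c] [b e] /genE /= -> [/= Zb ->].
  by congr pair; rewrite /= ?mulg1 ?mul1g.
Qed.

End DirectProduct.

(** * Counting square roots in the sixteen types *)

Lemma cyclic_generator_abelian (C : groupType) (t a b : C) :
  cyclic_generator t -> commute a b.
Proof. by move=> tC; apply: (@generated1_abelian _ t); rewrite tC. Qed.

Lemma D_axioms_facts (D : groupType) (x y t1 : D) (m1 : nat) :
  D_axioms x y t1 m1 ->
  [/\ central_quotient_klein D, ~ commute x y, period t1 (2 ^ m1.-1).*2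
    & commutator_elt D = t1 ^+ (2 ^ m1.-1)].
Proof.
case=> kD _ m1_gt0 t1o xyE.
have xyNC : ~ commute x y.
  move/commgP/eqP; rewrite xyE; have [_ _ + ] := t1o; apply.
  by rewrite expn_gt0 ltn_exp2l // prednK // leqnn.
split=> //; first exact: has_2power_order_period.
by rewrite -(commutator_eltE kD xyNC).
Qed.

Lemma at_least_0 (L : Type) (P : set L) R : at_least P R 0.
Proof.
by exists (fun i : 'I_0 => False_rect L (notF (ltn_ord i))); split=> [[]|[]].
Qed.

Lemma centerg1 (G : groupType) : centerg G 1.
Proof. by have [] := centerg_subgroup G. Qed.

Lemma starg1 (G : groupType) : starg (1 : G) = 1.
Proof. exact/starg_central/centerg1. Qed.

Section RootBounds.
Variables (D : groupType) (x y : D).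
Hypotheses (kleinD : central_quotient_klein D) (xyNC : ~ commute x y).
Local Notation Z := (centerg D).
Local Notation roots_at_least go :=
  (at_least (square_roots (Mloop go)) (@same_coset (Mloop go))).
Local Notation roots_at_most go :=
  (at_most (square_roots (Mloop go)) (@same_coset (Mloop go))).

(** There are only seven nontrivial cosets. *)
Lemma roots_at_most_7 go : Z go -> roots_at_most go 7.
Proof.
move=> Zgo.
pose cs := [:: (false, false, true); (false, true, false); (false, true, true);
  (true, false, false); (true, false, true); (true, true, false);
  (true, true, true)].
apply: (at_most_roots kleinD xyNC Zgo (cs := cs)).
by case=> [] [] [].
Qed.

Lemma inl_noncentral (go g : D) :
  ~ Z g -> ~ commutant (Mloop go) (inl g : Mloop go).
Proof.
by move=> NZg /(commutant_Mloop kleinD)[z Zz [gz]]; apply: NZg; rewrite gz.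
Qed.

Lemma inr_noncentral (go g : D) : ~ commutant (Mloop go) (inr g : Mloop go).
Proof. by move=> /(commutant_Mloop kleinD)[]. Qed.

Lemma x_noncentral : ~ Z x.
Proof. by move=> Zx; apply: xyNC. Qed.

(** The square of u is g_o = 1. *)
Lemma roots_at_least_1 : roots_at_least (1 : D) 1.
Proof.
apply: (at_least_roots kleinD xyNC (cs := [:: (false, false, true)])) => //.
move=> c; rewrite inE => /eqP ->; split; first exact: inr_noncentral.
exists 1; first exact: centerg1; rewrite /= !expg0 !mulg1.
by congr inl; rewrite starg1 ?mulg1.
Qed.

Lemma roots_at_least_2 : x ^+ 2 = 1 -> roots_at_least (1 : D) 2.
Proof.
move=> x2; apply: (at_least_roots kleinD xyNC
  (cs := [:: (false, false, true); (true, false, false)])) => //.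
move=> c; rewrite !inE => /orP[] /eqP ->.
  split; first exact: inr_noncentral.
  exists 1; first exact: centerg1.
  by congr inl; rewrite !expg0 !mulg1 starg1 ?mulg1.
split; first by apply: inl_noncentral; rewrite mulg1; apply: x_noncentral.
by exists 1; first exact: centerg1; congr inl; rewrite expg0 expg1 !mulg1.
Qed.

(** The square roots are u, x, y and (xy)u; the last one squares to s (xy)^2,
    which is s x^2 y^2 s. *)
Lemma roots_at_least_4 : x ^+ 2 = 1 -> y ^+ 2 = 1 -> roots_at_least (1 : D) 4.
Proof.
move=> x2 y2; apply: (at_least_roots kleinD xyNC
  (cs := [:: (false, false, true); (true, false, false);
             (false, true, false); (true, true, true)])) => //.
move=> c; rewrite !inE => /or4P[] /eqP ->.
- split; first exact: inr_noncentral.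
  exists 1; first exact: centerg1.
  by congr inl; rewrite !expg0 !mulg1 starg1 ?mulg1.
- split; first by apply: inl_noncentral; rewrite mulg1; apply: x_noncentral.
  by exists 1; first exact: centerg1; congr inl; rewrite expg0 expg1 !mulg1.
- split.
    apply: inl_noncentral; rewrite expg0 mul1g => Zy; apply: xyNC.
    exact/commute_sym.
  by exists 1; first exact: centerg1; congr inl; rewrite expg0 expg1 !mul1g.
- split; first exact: inr_noncentral.
  exists 1; first exact: centerg1.
  congr inl; rewrite !expg1 starg_noncentral; last first.
    move=> Zxy; have := noncentral_word xyNC (i := true) (j := true) (@centerg1 D).
    by rewrite !expg1 mulg1 => /(_ Zxy).
  rewrite mul1g -mulgA square_xy // (x2 : x * x = 1) (y2 : y * y = 1) !mul1g.
  exact: commutator_elt_sqr.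
Qed.

Variables (ts : seq D).
Hypotheses (tsZ : is_cyclic_dprod ts Z)
  (ts_even : {in ts, forall t, even_period t}).

(** The last clause applies to the commutator, which is a power of the first
    generator: all characters but the first kill it. *)
Lemma generator_characters : exists chi : nat -> D -> bool,
  [/\ forall i a b, Z a -> Z b -> chi i (a * b) = chi i a (+) chi i b,
      forall i j, i < size ts -> j < size ts -> chi i (nth 1 ts j) = (i == j)
    & forall i a n, Z a -> chi i a = false -> chi i (a ^+ n) = false].
Proof.
have [chi [chiM chi_t _ _]] := parity_characters tsZ ts_even.
have [_ ZM _] := centerg_subgroup D.
exists chi; split=> // i a n Za chia.
have chi1 : chi i 1 = false.
  by have := chiM i 1 1 (@centerg1 D) (@centerg1 D); rewrite mulg1; case: (chi i 1).
have [//] : chi i (a ^+ n) = false /\ Z (a ^+ n).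
elim: n => [|n [IHn ZIHn]]; first by rewrite expg0; split=> //; apply: centerg1.
by rewrite expgS chiM // chia IHn; split=> //; apply: ZM.
Qed.

End RootBounds.

Section RootUpperBounds.
Variables (D : groupType) (x y t1 : D) (n : nat).
Hypotheses (kleinD : central_quotient_klein D) (xyNC : ~ commute x y).
Hypothesis commE : commutator_elt D = t1 ^+ n.
Local Notation Z := (centerg D).
Local Notation roots_at_most :=
  (at_most (square_roots (Mloop t1)) (@same_coset (Mloop t1))).

(** The character is 1 on x^2, y^2 and g_o, so it is 1 on the squares of x, y,
    u and (xy)u, whatever its value on s. *)
Lemma roots_at_most_3 :
  is_cyclic_dprod [:: t1] Z -> {in [:: t1], forall t, even_period t} ->
  x ^+ 2 = t1 -> y ^+ 2 = t1 -> roots_at_most 3.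
Proof.
move=> tsZ ts_even; rewrite !expg2 => x2 y2.
have [chi [chiM chi_t _]] := generator_characters tsZ ts_even.
have Zt1 := cyclic_dprod_mem tsZ (mem_head _ _).
apply: (at_most_roots kleinD xyNC Zt1
  (cs := [:: (true, true, false); (true, false, true); (false, true, true)])).
move=> i j k ijk /(_ _ (chiM 0%N)); rewrite x2 y2 (chi_t 0 0)%N //.
by case: (chi _ _); case: i j k ijk => [] [] [].
Qed.

(** The second character forces j = 0, and then the first excludes x and u,
    leaving xu. *)
Lemma roots_at_most_1 t2 :
  is_cyclic_dprod [:: t1; t2] Z -> {in [:: t1; t2], forall t, even_period t} ->
  x ^+ 2 = t1 -> y ^+ 2 = t2 -> roots_at_most 1.
Proof.
move=> tsZ ts_even; rewrite !expg2 => x2 y2.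
have [chi [chiM chi_t chiX]] := generator_characters tsZ ts_even.
have Zt1 := cyclic_dprod_mem tsZ (mem_head _ _).
apply: (at_most_roots kleinD xyNC Zt1 (cs := [:: (true, false, true)])).
move=> i j k ijk H; move: (H _ (chiM 0%N)) (H _ (chiM 1%N)).
rewrite x2 y2 commE (chi_t 0 0)%N // (chi_t 0 1)%N //.
rewrite (chi_t 1 0)%N // (chi_t 1 1)%N //.
rewrite (chiX 1%N) // ?(chi_t 1 0)%N //.
by case: (chi _ _); case: i j k ijk {H} => [] [] [].
Qed.

(** The second and third characters force i = j = 0, and the first is 1 on
    g_o. *)
Lemma roots_at_most_0 t2 t3 :
  is_cyclic_dprod [:: t1; t2; t3] Z ->
  {in [:: t1; t2; t3], forall t, even_period t} ->
  x ^+ 2 = t2 -> y ^+ 2 = t3 -> roots_at_most 0.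
Proof.
move=> tsZ ts_even; rewrite !expg2 => x2 y2.
have [chi [chiM chi_t chiX]] := generator_characters tsZ ts_even.
have Zt1 := cyclic_dprod_mem tsZ (mem_head _ _).
apply: (at_most_roots kleinD xyNC Zt1 (cs := [::])).
move=> i j k ijk H; move: (H _ (chiM 0%N)) (H _ (chiM 1%N)) (H _ (chiM 2)).
rewrite x2 y2 commE !(chi_t _ 1)%N // !(chi_t _ 2)%N // !(chi_t _ 0)%N //.
rewrite (chiX 1%N) // ?(chi_t 1 0)%N // (chiX 2) // ?(chi_t 2 0)%N //.
by case: (chi _ _); case: i j k ijk {H} => [] [] [].
Qed.

End RootUpperBounds.

Definition has_periods (G : groupType) (ths : seq (G * nat)) : Prop :=
  {in ths, forall th, period th.1 th.2.*2}.

Lemma has_periods_even (G : groupType) (ths : seq (G * nat)) :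
  has_periods ths -> {in unzip1 ths, forall t, even_period t}.
Proof. by move=> thsP _ /mapP[th /thsP thP ->]; exists th.2. Qed.

Lemma has_periods_cons (G : groupType) (t : G) h ths :
  period t h.*2 -> has_periods ths -> has_periods ((t, h) :: ths).
Proof. by move=> th thsP u; rewrite inE => /orP[/eqP ->|/thsP]. Qed.

Lemma has_periods_nil (G : groupType) : has_periods ([::] : seq (G * nat)).
Proof. by []. Qed.

Lemma profile_Mloop (G : groupType) (go : G) (ths : seq (G * nat)) lo hi :
    central_quotient_klein G ->
    has_periods ths -> is_cyclic_dprod (unzip1 ths) (centerg G) ->
    at_least (square_roots (Mloop go)) (@same_coset (Mloop go)) lo ->
    at_most (square_roots (Mloop go)) (@same_coset (Mloop go)) hi ->
  profile (Mloop go) (count (fun th => 0 < th.2) ths) (size ths) lo hi.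
Proof.
move=> kG thsP thsZ ge_lo le_hi.
have [inv_ge inv_le] := involutions_Mloop go kG thsZ thsP.
have [sq_ge sq_le] := square_classes_Mloop go kG thsZ (has_periods_even thsP).
by rewrite size_map in sq_ge sq_le; split.
Qed.

Lemma profile_prod (D C : groupType) (x y : D) (t : C) h (ths : seq (D * nat)) :
    central_quotient_klein D -> ~ commute x y ->
    has_periods ths -> is_cyclic_dprod (unzip1 ths) (centerg D) ->
    cyclic_generator t -> period t h.*2 ->
  profile (@Mloop (D * C)%type (1, t))
    ((0 < h) + count (fun th => 0 < th.2) ths) (size ths).+1 0 7.
Proof.
move=> kD xyNC thsP thsZ tC th.
have CC (a b : C) := cyclic_generator_abelian a b tC.
pose ths' := ((1, t) : (D * C)%type, h)
  :: [seq ((u.1, 1) : (D * C)%type, u.2) | u <- ths].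
have := @profile_Mloop _ ((1, t) : (D * C)%type) ths' 0 7.
rewrite /= count_map size_map; apply.
- exact: klein_prod.
- apply: has_periods_cons; first exact: period_inr.
  by move=> _ /mapP[u /thsP uP ->]; apply: period_inl.
- have := cyclic_dprod_prod CC thsZ tC.
  by rewrite /unzip1 -!map_comp.
- exact: at_least_0.
- apply: (@roots_at_most_7 _ ((x, 1) : (D * C)%type) (y, 1)).
  + exact: klein_prod.
  + by case=> /xyNC.
  + by rewrite centerg_prod //= => d; rewrite /commute mul1g mulg1.
Qed.

(** * Separating the types *)

(** The list starts with a value for the index 0, which is not a type.  In
    each entry (n, k, lo, hi) the last two numbers bound the number of cosets of
    square roots; 0 and 7 are the trivial bounds. *)
Definition type_profile (i : nat) : nat * nat * nat * nat :=
  nth (0, 0, 0, 0)%N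
    [:: (0, 0, 0, 0);
        (1, 1, 4, 7); (1, 1, 0, 3); (2, 2, 2, 7); (2, 2, 0, 1);
        (1, 2, 2, 7); (1, 2, 0, 1); (3, 3, 1, 7); (3, 3, 0, 0);
        (4, 4, 0, 7); (2, 3, 1, 7); (2, 3, 0, 0); (3, 4, 0, 7);
        (2, 4, 0, 7); (1, 3, 1, 7); (1, 3, 0, 0); (1, 4, 0, 7)]%N i.

Definition profiled (L : magmaType) (q : nat * nat * nat * nat) : Prop :=
  let: (n, k, lo, hi) := q in profile L n k lo hi.

(** The numbers attached to the generators are half their orders: 2^(m-1) for a
    generator of order 2^m, and 0 for one of infinite order. *)
Lemma loop_of_type_profile i L :
  loop_of_type i L -> i <= 16 /\ profiled L (type_profile i).
Proof.
have fin (G : groupType) (t : G) m :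
    has_2power_order t m -> period t (2 ^ m.-1).*2.
  by case; apply: has_2power_order_period.
have inf (G : groupType) (t : G) : has_infinite_order t -> period t 0.*2.
  exact: has_infinite_order_period.
case=> D x y t1.
- move=> m1 /D_axioms_facts[kD xyNC P1 _]
    tsZ x2 y2; split=> //.
  have thsP := has_periods_cons P1 (@has_periods_nil D).
  have := profile_Mloop kD thsP tsZ
    (roots_at_least_4 kD xyNC x2 y2)
    (roots_at_most_7 kD xyNC (@centerg1 D)).
  by rewrite /= ?expn_gt0.
- move=> m1 /D_axioms_facts[kD xyNC P1 _]
    tsZ x2 y2; split=> //.
  have thsP := has_periods_cons P1 (@has_periods_nil D).
  have := profile_Mloop kD thsP tsZ
    (@at_least_0 _ _ _)
    (roots_at_most_3 kD xyNC tsZ (has_periods_even thsP) x2 y2).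
  by rewrite /= ?expn_gt0.
- move=> t2 m1 m2 /D_axioms_facts[kD xyNC P1 _]
    /fin P2 tsZ x2 y2; split=> //.
  have thsP := has_periods_cons P1 (has_periods_cons P2 (@has_periods_nil D)).
  have := profile_Mloop kD thsP tsZ
    (roots_at_least_2 kD xyNC x2)
    (roots_at_most_7 kD xyNC (@centerg1 D)).
  by rewrite /= ?expn_gt0.
- move=> t2 m1 m2 /D_axioms_facts[kD xyNC P1 sE]
    /fin P2 tsZ x2 y2; split=> //.
  have thsP := has_periods_cons P1 (has_periods_cons P2 (@has_periods_nil D)).
  have := profile_Mloop kD thsP tsZ
    (@at_least_0 _ _ _)
    (roots_at_most_1 kD xyNC sE tsZ (has_periods_even thsP) x2 y2).
  by rewrite /= ?expn_gt0.
- move=> u1 m1 /D_axioms_facts[kD xyNC P1 _]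
    /inf P2 tsZ x2 y2; split=> //.
  have thsP := has_periods_cons P1 (has_periods_cons P2 (@has_periods_nil D)).
  have := profile_Mloop kD thsP tsZ
    (roots_at_least_2 kD xyNC x2)
    (roots_at_most_7 kD xyNC (@centerg1 D)).
  by rewrite /= ?expn_gt0.
- move=> u1 m1 /D_axioms_facts[kD xyNC P1 sE]
    /inf P2 tsZ x2 y2; split=> //.
  have thsP := has_periods_cons P1 (has_periods_cons P2 (@has_periods_nil D)).
  have := profile_Mloop kD thsP tsZ
    (@at_least_0 _ _ _)
    (roots_at_most_1 kD xyNC sE tsZ (has_periods_even thsP) x2 y2).
  by rewrite /= ?expn_gt0.
- move=> t2 t3 m1 m2 m3 /D_axioms_facts[kD xyNC P1 _]
    /fin P2 /fin P3 tsZ x2 y2; split=> //.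
  have thsP := has_periods_cons P1
    (has_periods_cons P2 (has_periods_cons P3 (@has_periods_nil D))).
  have := profile_Mloop kD thsP tsZ
    (roots_at_least_1 kD xyNC)
    (roots_at_most_7 kD xyNC (@centerg1 D)).
  by rewrite /= ?expn_gt0.
- move=> t2 t3 m1 m2 m3 /D_axioms_facts[kD xyNC P1 sE]
    /fin P2 /fin P3 tsZ x2 y2; split=> //.
  have thsP := has_periods_cons P1
    (has_periods_cons P2 (has_periods_cons P3 (@has_periods_nil D))).
  have := profile_Mloop kD thsP tsZ
    (@at_least_0 _ _ _)
    (roots_at_most_0 kD xyNC sE tsZ (has_periods_even thsP) x2 y2).
  by rewrite /= ?expn_gt0.
- move=> t2 t3 m1 m2 m3 C t k /D_axioms_facts[kD xyNC P1 _]
    /fin P2 /fin P3 tsZ x2 y2 tC /fin Pt; split=> //.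
  have thsP := has_periods_cons P1
    (has_periods_cons P2 (has_periods_cons P3 (@has_periods_nil D))).
  by have := profile_prod kD xyNC thsP tsZ tC Pt; rewrite /= ?expn_gt0.
- move=> t2 u1 m1 m2 /D_axioms_facts[kD xyNC P1 _]
    /fin P2 /inf P3 tsZ x2 y2; split=> //.
  have thsP := has_periods_cons P1
    (has_periods_cons P2 (has_periods_cons P3 (@has_periods_nil D))).
  have := profile_Mloop kD thsP tsZ
    (roots_at_least_1 kD xyNC)
    (roots_at_most_7 kD xyNC (@centerg1 D)).
  by rewrite /= ?expn_gt0.
- move=> t2 u1 m1 m2 /D_axioms_facts[kD xyNC P1 sE]
    /fin P2 /inf P3 tsZ x2 y2; split=> //.
  have thsP := has_periods_cons P1
    (has_periods_cons P2 (has_periods_cons P3 (@has_periods_nil D))).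
  have := profile_Mloop kD thsP tsZ
    (@at_least_0 _ _ _)
    (roots_at_most_0 kD xyNC sE tsZ (has_periods_even thsP) x2 y2).
  by rewrite /= ?expn_gt0.
- move=> t2 u1 m1 m2 C t k /D_axioms_facts[kD xyNC P1 _]
    /fin P2 /inf P3 tsZ x2 y2 tC /fin Pt; split=> //.
  have thsP := has_periods_cons P1
    (has_periods_cons P2 (has_periods_cons P3 (@has_periods_nil D))).
  by have := profile_prod kD xyNC thsP tsZ tC Pt; rewrite /= ?expn_gt0.
- move=> t2 u1 m1 m2 C w /D_axioms_facts[kD xyNC P1 _]
    /fin P2 /inf P3 tsZ x2 y2 tC /inf Pt; split=> //.
  have thsP := has_periods_cons P1
    (has_periods_cons P2 (has_periods_cons P3 (@has_periods_nil D))).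
  by have := profile_prod kD xyNC thsP tsZ tC Pt; rewrite /= ?expn_gt0.
- move=> u1 u2 m1 /D_axioms_facts[kD xyNC P1 _]
    /inf P2 /inf P3 tsZ x2 y2; split=> //.
  have thsP := has_periods_cons P1
    (has_periods_cons P2 (has_periods_cons P3 (@has_periods_nil D))).
  have := profile_Mloop kD thsP tsZ
    (roots_at_least_1 kD xyNC)
    (roots_at_most_7 kD xyNC (@centerg1 D)).
  by rewrite /= ?expn_gt0.
- move=> u1 u2 m1 /D_axioms_facts[kD xyNC P1 sE]
    /inf P2 /inf P3 tsZ x2 y2; split=> //.
  have thsP := has_periods_cons P1
    (has_periods_cons P2 (has_periods_cons P3 (@has_periods_nil D))).
  have := profile_Mloop kD thsP tsZ
    (@at_least_0 _ _ _)
    (roots_at_most_0 kD xyNC sE tsZ (has_periods_even thsP) x2 y2).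
  by rewrite /= ?expn_gt0.
- move=> u1 u2 m1 C w /D_axioms_facts[kD xyNC P1 _]
    /inf P2 /inf P3 tsZ x2 y2 tC /inf Pt; split=> //.
  have thsP := has_periods_cons P1
    (has_periods_cons P2 (has_periods_cons P3 (@has_periods_nil D))).
  by have := profile_prod kD xyNC thsP tsZ tC Pt; rewrite /= ?expn_gt0.
Qed.

Definition separated (p q : nat * nat * nat * nat) : bool :=
  let: (n1, k1, lo1, hi1) := p in let: (n2, k2, lo2, hi2) := q in
  ~~ [&& n1 == n2, k1 == k2, lo1 <= hi2 & lo2 <= hi1].

Lemma type_profiles_separated i j : i <= 16 -> j <= 16 -> i <> j ->
  separated (type_profile i) (type_profile j).
Proof.
pose good i j := (i == j) || separated (type_profile i) (type_profile j).
have H : all (fun i => all (good i) (iota 0 17)) (iota 0 17) by vm_compute.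
move=> lei lej /eqP /negbTE neq_ij.
move/allP: H => /(_ i); rewrite mem_iota => /(_ lei) /allP /(_ j).
by rewrite mem_iota /good neq_ij; apply.
Qed.

Lemma isomorphic_not_separated (L1 L2 : magmaType) p q :
  isomorphic L1 L2 -> profiled L1 p -> profiled L2 q -> ~~ separated p q.
Proof.
case=> f f_bij; case: p q => [[[n1 k1] lo1] hi1] [[[n2 k2] lo2] hi2] /= p1 p2.
have fM : {morph f : a b / a * b} by exact: gmulfM.
have [n12 k12 lo1_hi2] := profile_leq fM f_bij p1 p2.
have [g fK gK] := f_bij.
have gM : {morph g : a b / a * b}.
  by move=> a b; apply: (can_inj fK); rewrite fM !gK.
have [n21 k21 lo2_hi1] := profile_leq gM (Bijective gK fK) p2 p1.
by rewrite negbK !eqn_leq n12 n21 k12 k21 lo1_hi2 lo2_hi1.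
Qed.

Theorem theorem4p2 (i j : nat) (L1 L2 : magmaType) :
  i <> j -> loop_of_type i L1 -> loop_of_type j L2 -> ~ isomorphic L1 L2.
Proof.
move=> neq_ij /loop_of_type_profile[lei p1] /loop_of_type_profile[lej p2] iso.
have := isomorphic_not_separated iso p1 p2; apply/negP; rewrite negbK.
exact: type_profiles_separated.
Qed.
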